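(* There exists a family $(\phi_n)_{n\ge1}$ of 3-CNF formulas, $\phi_n$ having $O(n)$ variables (and size polynomial in $n$), such that the extension complexity of the satisfiability polytope of $\phi_n$ is not bounded by any polynomial in $n$, and such that in each $\phi_n$ every variable occurs at most twice non-negated and at most once negated.
   Context: For a CNF formula $\phi$ in variables $x_1,\dots,x_N$, the satisfiability polytope of $\phi$ is the convex hull in $\mathbb{R}^N$ of all 0/1 vectors that are satisfying assignments of $\phi$. A 3-CNF formula is a conjunction of clauses each being a disjunction of three literals. The extension complexity $\mathrm{xc}(Q)$ of a polytope $Q$ is the minimum number of facets of a polytope $Q'$ such that $Q$ is a linear image of $Q'$. *)

(* Defs.v *)
From Stdlib Require Import Reals.
From mathcomp Require Import all_boot.

Set Implicit Arguments.
Unset Strict Implicit.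
Unset Printing Implicit Defensive.

Definition vec (m : nat) := 'I_m -> R.

Definition dot (m : nat) (a y : vec m) : R :=
  \big[Rplus/R0]_(i < m) (Rmult (a i) (y i)).

Definition in_conv_hull (m : nat) (S : vec m -> Prop) (x : vec m) : Prop :=
  exists (k : nat) (pts : 'I_k -> vec m) (lam : 'I_k -> R),
    (forall j, Rle R0 (lam j) /\ S (pts j)) /\
    \big[Rplus/R0]_(j < k) lam j = R1 /\
    (forall i, x i = \big[Rplus/R0]_(j < k) (Rmult (lam j) (pts j i))).

Definition is_polytope (m : nat) (Q : vec m -> Prop) : Prop :=
  exists (k : nat) (pts : 'I_k -> vec m),
    forall y, Q y <-> in_conv_hull (fun z => exists j, z = pts j) y.

Definition is_face (m : nat) (Q F : vec m -> Prop) : Prop :=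
  (exists (a : vec m) (beta : R),
      (forall y, Q y -> Rle (dot a y) beta) /\
      (forall y, F y <-> (Q y /\ dot a y = beta))) /\
  (exists y, F y).

Definition is_facet (m : nat) (Q F : vec m -> Prop) : Prop :=
  is_face Q F /\
  (exists y, Q y /\ ~ F y) /\
  (forall G, is_face Q G -> (forall y, F y -> G y) ->
     (forall y, G y -> F y) \/ (forall y, Q y -> G y)).

Definition at_most_facets (m : nat) (Q : vec m -> Prop) (k : nat) : Prop :=
  exists Fs : 'I_k -> (vec m -> Prop),
    forall F, is_facet Q F -> exists j, forall y, F y <-> Fs j y.

Definition xc_le (N : nat) (P : vec N -> Prop) (k : nat) : Prop :=
  exists (m : nat) (Q : vec m -> Prop) (L : 'I_N -> vec m),
    is_polytope Q /\ at_most_facets Q k /\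
    (forall x, P x <-> exists y, Q y /\ forall i, x i = dot (L i) y).

(* a literal: (variable, polarity); polarity true = non-negated *)
Definition lit (N : nat) := ('I_N * bool)%type.
Definition clause (N : nat) := 3.-tuple (lit N).
Definition cnf (N : nat) := seq (clause N).

Definition lit_sat (N : nat) (x : 'I_N -> bool) (l : lit N) : bool :=
  x l.1 == l.2.

Definition cnf_sat (N : nat) (phi : cnf N) (x : 'I_N -> bool) : bool :=
  all (fun c : clause N => has (lit_sat x) c) phi.

Definition proper_3cnf (N : nat) (phi : cnf N) : bool :=
  all (fun c : clause N => uniq (map fst (tval c))) phi.

Definition pos_occ (N : nat) (phi : cnf N) (v : 'I_N) : nat :=
  sumn (map (fun c : clause N => count (fun l : lit N => l == (v, true)) c) phi).
Definition neg_occ (N : nat) (phi : cnf N) (v : 'I_N) : nat :=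
  sumn (map (fun c : clause N => count (fun l : lit N => l == (v, false)) c) phi).

Definition sat_polytope (N : nat) (phi : cnf N) : vec N -> Prop :=
  in_conv_hull (fun z => exists x : 'I_N -> bool,
                  cnf_sat phi x /\ forall i, z i = (if x i then R1 else R0)).

(* Main.v *)
Require Import Defs.
From Stdlib Require Import Reals.
From mathcomp Require Import all_boot.
From mathcomp Require Import all_order all_algebra.
From mathcomp Require Import boolp Rstruct ring lra zify.

Import Order.TTheory GRing.Theory Num.Theory.

Set Implicit Arguments.
Unset Strict Implicit.
Unset Printing Implicit Defensive.

(* The formula has bits b_1, ..., b_n, each represented by copies of its
   negation linked by a chain of implications, and variables x_ij that are
   forced to be true when b_i and b_j are (i < j). Each implication carries a
   fresh pad variable as its third literal; a large coefficient on the pads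
   makes an inequality that is valid when they vanish valid everywhere. For a
   set a of indices, the inequality
     |a| <= 1 + sum_(i in a) (1 - b_i) + sum_(i < j in a) x_ij + n * sum pads
   is valid, and at the 0/1 point of a set b it is strict if a and b are
   disjoint and tight if they meet in exactly one index.

   If Q is an extension, each inequality cuts out a face F of Q, and a point y
   of Q outside F is outside some facet G containing F. Hence every facet G gives
   a rectangle {a | F_a in G} x {b | y_b not in G}; these rectangles cover all
   disjoint pairs (a, b) with a nonempty and contain no pair with |a & b| = 1.
   By the argument of Kaibel and Weltge, such a rectangle contains at most 2^n
   of the 3^n disjoint pairs. *)

(** * Facets of polytopes, and rectangle covers from extensions *)

Section Facets.
Local Open Scope ring_scope.

Lemma dotE m (a y : vec m) : dot a y = \sum_(i < m) a i * y i.
Proof. by []. Qed.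

Lemma hull_base m (S : vec m -> Prop) z : S z -> in_conv_hull S z.
Proof.
move=> Sz; exists 1%N, (fun=> z), (fun=> 1); split; [|split].
- by move=> _; split=> //; apply/RleP; rewrite ler01.
- by rewrite big_ord1.
- by move=> i; rewrite big_ord1; exact: (esym (mul1r (z i))).
Qed.

(* [T] is the set of points of positive weight. *)
Lemma hull_carrier m (S : vec m -> Prop) y : in_conv_hull S y ->
  exists T : vec m -> Prop, [/\ exists z, T z, forall z, T z -> S z &
    forall a beta, (forall z, S z -> dot a z <= beta) ->
      dot a y <= beta /\ (dot a y = beta <-> forall z, T z -> dot a z = beta)].
Proof.
move=> [k [pts [lam [lamP [lam1 yE]]]]].
have lam0 j : 0 <= lam j by apply/RleP; case: (lamP j).
have {}yE i : y i = \sum_(j < k) lam j * pts j i := yE i.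
have {}lam1 : \sum_(j < k) lam j = 1 by [].
exists (fun z => exists2 j, 0 < lam j & z = pts j); split.
- have [[j lj]|lam_le0] := pselect (exists j, 0 < lam j); first by exists (pts j); exists j.
  have := oner_neq0 R; rewrite -lam1 big1 ?eqxx // => j _; apply/eqP.
  by rewrite eq_le lam0 andbT leNgt; apply/negP => lj; apply: lam_le0; exists j.
- by move=> z [j _ ->]; case: (lamP j).
move=> a beta ab.
(* The slack at [y] is the weighted mean of the slacks at the points, which are all nonnegative. *)
have slackE : beta - dot a y = \sum_(j < k) lam j * (beta - dot a (pts j)).
  under eq_bigr do rewrite mulrBr.
  rewrite sumrB -mulr_suml lam1 mul1r; congr (_ - _).
  under [RHS]eq_bigr do rewrite dotE mulr_sumr.
  rewrite dotE exchange_big /=; apply: eq_bigr => i _.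
  rewrite yE mulr_sumr.
  by apply: eq_bigr => j _; rewrite mulrCA.
have sl0 j : 0 <= lam j * (beta - dot a (pts j)).
  by rewrite mulr_ge0 // subr_ge0 ab //; case: (lamP j).
split; first by rewrite -subr_ge0 slackE sumr_ge0.
split=> [ye z [j lj ->]|tight].
  move/eqP: slackE; rewrite ye subrr eq_sym psumr_eq0 // => /allP /(_ j).
  rewrite mem_index_enum => /(_ isT) /=; rewrite mulf_eq0 gt_eqF //= subr_eq0.
  by move/eqP.
apply/esym/eqP; rewrite -subr_eq0 slackE big1 // => j _.
have [lj|] := ltP 0 (lam j); first by rewrite (tight (pts j)) ?subrr ?mulr0 //; exists j.
by move=> lj; rewrite (_ : lam j = 0) ?mul0r //; apply/eqP; rewrite eq_le lj lam0.
Qed.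

(** Induction on the size of the support. If [s] is not minimal, some nonzero [t] has strictly
    smaller support, and it replaces [s] when [t i] is positive. Otherwise [t i] is 0: subtracting
    the largest multiple of [t] that keeps [s] nonnegative kills a coordinate and leaves [s i]
    unchanged. *)
Lemma minimal_support (I : finType) (W : (I -> R) -> Prop) :
  (forall s t theta, W s -> W t -> W (fun j => s j - theta * t j)) ->
  forall s i, W s -> (forall j, 0 <= s j) -> 0 < s i ->
  exists s', [/\ W s', forall j, 0 <= s' j, forall j, s j = 0 -> s' j = 0, 0 < s' i &
    forall t, W t -> (forall j, 0 <= t j) -> (forall j, s' j = 0 -> t j = 0) ->
      (forall j, t j = 0) \/ (forall j, t j = 0 -> s' j = 0)].
Proof.
move=> WB s i; have [n] := ubnP #|[pred j | s j != 0]|.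
elim: n => // n IHn in s *; rewrite ltnS => sn Ws s0 si.
have step s1 j : W s1 -> (forall j, 0 <= s1 j) -> (forall j, s j = 0 -> s1 j = 0) ->
    0 < s1 i -> s j != 0 -> s1 j = 0 ->
  exists s', [/\ W s', forall j, 0 <= s' j, forall j, s j = 0 -> s' j = 0, 0 < s' i &
    forall t, W t -> (forall j, 0 <= t j) -> (forall j, s' j = 0 -> t j = 0) ->
      (forall j, t j = 0) \/ (forall j, t j = 0 -> s' j = 0)].
  move=> Ws1 s10 s1s s1i sj s1j; have [|//|//|//|s' [? ? ss' ? ?]] := IHn s1.
    apply: leq_trans sn; apply/proper_card/properP; split.
      by apply/subsetP => l; rewrite !inE; apply: contra => /eqP /s1s ->.
    by exists j; rewrite !inE ?s1j ?eqxx.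
  by exists s'; split=> // l /s1s /ss'.
have [smin|] := pselect (forall t, W t -> (forall j, 0 <= t j) ->
    (forall j, s j = 0 -> t j = 0) ->
    (forall j, t j = 0) \/ (forall j, t j = 0 -> s j = 0)); first by exists s.
move/existsNP => [t /not_implyP[Wt /not_implyP[t0 /not_implyP[st]]]].
move/not_orP => [/existsNP[l /eqP tl] /existsNP[j /not_implyP[tj /eqP sj]]].
have [ti|ti] := ltP 0 (t i); first exact: (step t j).
have {}tl : 0 < t l by rewrite lt_def tl t0.
pose r := Order.arg_min l (fun h => 0 < t h) (fun h => s h / t h).
have [tr rmin] : 0 < t r /\ forall h, 0 < t h -> s r / t r <= s h / t h.
  by rewrite /r; case: arg_minP.
apply: (step (fun h => s h - s r / t r * t h) r).
- exact: WB.
- move=> h; rewrite subr_ge0.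
  have [th|th] := ltP 0 (t h); first by rewrite -ler_pdivlMr // rmin.
  by apply: le_trans (s0 h); rewrite mulr_ge0_le0 // divr_ge0.
- by move=> h sh; rewrite sh (st h sh) mulr0 subrr.
- by rewrite (_ : t i = 0) ?mulr0 ?subr0 //; apply/eqP; rewrite eq_le ti t0.
- by apply/eqP => /st tr0; rewrite tr0 ltxx in tr.
- by rewrite divfK ?subrr // gt_eqF.
Qed.

(* On the generating points, the slacks of the valid inequalities form the
   nonnegative part of a linear space; those of minimal support define facets. *)
Lemma face_sub_facet m (Q F : vec m -> Prop) y :
  is_polytope Q -> is_face Q F -> Q y -> ~ F y ->
  exists G, [/\ is_facet Q G, forall z, F z -> G z & ~ G y].
Proof.
move=> [k [pts QE]] [[a [beta [ab FE]]] [y0 Fy0]] Qy Fy.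
pose S z := exists j, z = pts j.
have Qpts j : Q (pts j) by apply/QE/hull_base; exists j.
pose slack (c : vec m) gamma j := gamma - dot c (pts j).
pose W (s : 'I_k -> R) := exists c gamma, forall j, s j = slack c gamma j.
have WB s t theta : W s -> W t -> W (fun j => s j - theta * t j).
  move=> [c [gamma sE]] [d [delta tE]].
  exists (fun i => c i - theta * d i), (gamma - theta * delta) => j.
  rewrite sE tE /slack !dotE; under [in RHS]eq_bigr do rewrite mulrBl -mulrA.
  by rewrite sumrB -mulr_sumr; ring.
have valid c gamma : (forall j, 0 <= slack c gamma j) -> forall z, S z -> dot c z <= gamma.
  by move=> sl0 _ [j ->]; rewrite -subr_ge0; apply: sl0.
have validQ c gamma : (forall z, Q z -> Rle (dot c z) gamma) -> forall j, 0 <= slack c gamma j.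
  by move=> cQ j; rewrite subr_ge0; apply/RleP/cQ.
have [T [[z Tz] TS Tval]] := hull_carrier (proj1 (QE y) Qy).
have sab0 := validQ _ _ ab.
(* As [y] is off [F], so is some point of its carrier; any face that misses this point misses
   [y]. *)
have [i Ti si] : exists2 i, T (pts i) & 0 < slack a beta i.
  apply: contrapT => sle; apply/Fy/FE; split=> //.
  have [_ ->] := Tval _ _ (valid _ _ sab0) => w Tw; have [j wE] := TS _ Tw.
  rewrite wE in Tw *.
  apply/eqP; rewrite eq_le -subr_ge0 sab0 /= -subr_le0 leNgt.
  by apply/negP => ?; apply: sle; exists j.

have Ws : W (slack a beta) by exists a, beta.
have [_ [[c [gamma /funext ->]] sl0 F0 si' smin]] := minimal_support WB Ws sab0 si.
pose G z := Q z /\ dot c z = gamma.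
have [T0 [[z0 T0z0] T0S T0val]] := hull_carrier (proj1 (QE y0) (proj1 (proj1 (FE y0) Fy0))).
(* Tightness on [Q] is decided at the generating points, so an inclusion between zero sets of slacks
   gives an inclusion of faces. *)
have tight_sub d delta d' delta' : (forall j, 0 <= slack d delta j) ->
    (forall j, 0 <= slack d' delta' j) ->
    (forall j, slack d delta j = 0 -> slack d' delta' j = 0) ->
    forall w, Q w -> dot d w = delta -> dot d' w = delta'.
  move=> d0 d'0 dd' w /QE/hull_carrier[Tw [_ TwS Twval]].
  have [_ ->] := Twval _ _ (valid _ _ d0); have [_ ->] := Twval _ _ (valid _ _ d'0).
  move=> tight v Tv; have [j vE] := TwS _ Tv; move/eqP: (tight _ Tv).
  by rewrite vE eq_sym -subr_eq0 => /eqP/dd'/eqP; rewrite subr_eq0 => /eqP.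
have FG w : F w -> G w.
  by move=> /FE[Qw ?]; split=> //; apply: (tight_sub a beta).
exists G; split=> //; last first.
  move=> [_]; have [_ ->] := Tval _ _ (valid _ _ sl0) => /(_ _ Ti).
  by move=> ti; move: si'; rewrite /slack ti subrr ltxx.
have Gi : ~ G (pts i) by move=> [_ ti]; move: si'; rewrite /slack ti subrr ltxx.
split; [split|split].
- exists c, gamma; split=> // w /QE/hull_carrier[Tw [_ _ Twval]].
  by apply/RleP; have [] := Twval _ _ (valid _ _ sl0).
- by exists y0; apply: FG.
- by exists (pts i).
move=> H [[d [delta [/validQ d0 HE]]] _] GH.
have Wd : W (slack d delta) by exists d, delta.
(* Since [H] contains [G], its slack vanishes wherever that of [c] does. By minimality it vanishes
   everywhere, so [H] is [Q], or only where that of [c] does, so [H] lies in [G]. *)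
have [j /eqP|alltight|le] := smin _ Wd d0.
- rewrite subr_eq0 => /eqP ctight; have /GH/HE[_ dtight] : G (pts j) by split.
  by rewrite /slack dtight subrr.
- right=> w Qw; apply/HE; split=> //.
  have {Qw}/QE/hull_carrier[Tw [_ TwS Twval]] := Qw.
  have [_ ->] := Twval _ _ (valid _ _ d0) => v /TwS[j ->].
  by apply/esym/eqP; rewrite -subr_eq0; apply/eqP/alltight.
- by left=> w /HE[Qw ?]; split=> //; apply: (tight_sub d delta).
Qed.

Lemma rectangle_cover N (P : vec N -> Prop) k (A B : Type)
    (w : A -> vec N) (delta : A -> R) (x : B -> vec N) :
  xc_le P k ->
  (forall a z, P z -> dot (w a) z <= delta a) ->
  (forall b, P (x b)) ->
  exists (rows : 'I_k -> pred A) (cols : 'I_k -> pred B),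
    (forall j a b, rows j a -> cols j b -> dot (w a) (x b) <> delta a) /\
    (forall a b, (exists2 z, P z & dot (w a) z = delta a) ->
       dot (w a) (x b) <> delta a -> exists j, rows j a && cols j b).
Proof.
move=> [m [Q [L [Qpoly [[Fs FsP] PE]]]]] wP Px.
have /choice[y yP] b : exists y, Q y /\ forall i, x b i = dot (L i) y by apply/PE.
(* The pullback of the functional [w a] along the projection [L]. *)
pose w' a : vec m := fun l => \sum_(i < N) w a i * L i l.
have w'E a v z : (forall i, z i = dot (L i) v) -> dot (w' a) v = dot (w a) z.
  move=> zE; rewrite !dotE; under [RHS]eq_bigr do rewrite zE dotE mulr_sumr.
  rewrite exchange_big /=; apply: eq_bigr => l _; rewrite mulr_suml.
  by apply: eq_bigr => i _; rewrite mulrA.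
pose F a v := Q v /\ dot (w' a) v = delta a.
exists (fun j a => `[< forall v, F a v -> Fs j v >]), (fun j b => `[< ~ Fs j (y b) >]).
split=> [j a b /asboolP FFs /asboolP nF|a b [z /PE[v [Qv zE]] tz]];
  have [Qy xE] := yP b; rewrite -(w'E _ _ _ xE) => nt; first exact/nF/FFs.
have Fface : is_face Q (F a).
  split; last by exists v; split=> //; rewrite (w'E _ _ z).
  exists (w' a), (delta a); split=> // u Qu.
  rewrite (w'E _ _ (fun i => dot (L i) u)) //.
  by apply/RleP/wP/PE; exists u.
have nFy : ~ F a (y b) by case.
have [G [/FsP[j GE] FG Gy]] := face_sub_facet Qpoly Fface Qy nFy.
exists j; apply/andP; split; apply/asboolP; last by move/GE.
by move=> u /FG/GE.
Qed.

End Facets.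

(** * Rectangles among disjoint pairs of sets *)

(* Remove a point [x] of [D]: of the lifts [(x |: a, b)] and [(a, x |: b)] of a
   disjoint pair, at most one is in [A], since [x |: a] and [x |: b] meet in [x] only.
   Hence the pairs with [x] outside [p.2] and those with [x] outside [p.1], with
   [x] deleted, are together at least as many as the pairs of [A]. *)
Lemma card_udisj_rect (T : finType) (D : {set T}) (A : {set {set T} * {set T}}) :
  (forall p, p \in A -> (p.1 \subset D) && (p.2 \subset D)) ->
  (forall p, p \in A -> [disjoint p.1 & p.2]) ->
  (forall p q, p \in A -> q \in A -> #|p.1 :&: q.2| != 1) ->
  #|A| <= 2 ^ #|D|.
Proof.
move En: #|D| => n; elim: n => [|n IHn] in D En A *; move=> AD Adisj Ane1.
  rewrite expn0 -(cards1 (set0 : {set T}, set0 : {set T})).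
  apply/subset_leq_card/subsetP => -[a b] /AD /=.
  by rewrite (cards0_eq En) !subset0 inE xpair_eqE.
have /card_gt0P [x Dx] : 0 < #|D| by rewrite En.
have Dn' : #|D :\ x| = n by have := cardsD1 x D; rewrite Dx En; lia.
pose A0 := [set p in A | (x \notin p.1) && (x \notin p.2)].
pose A1 := [set p in A | x \in p.1]; pose A2 := [set p in A | x \in p.2].
pose f1 (p : {set T} * {set T}) := (p.1 :\ x, p.2).
pose f2 (p : {set T} * {set T}) := (p.1, p.2 :\ x).
have A1x p : p \in A1 -> [/\ p \in A, x \in p.1 & x \notin p.2].
  by rewrite inE => /andP[Ap xp]; rewrite (disjointFr (Adisj _ Ap)).
have A2x p : p \in A2 -> [/\ p \in A, x \in p.2 & x \notin p.1].
  by rewrite inE => /andP[Ap xp]; rewrite (disjointFl (Adisj _ Ap)).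
have cA1 : #|f1 @: A1| = #|A1|.
  apply: card_in_imset => -[a b] [c d] /A1x[/= _ xa _] /A1x[/= _ xc _] [ac ->].
  by rewrite -(setD1K xa) ac setD1K.
have cA2 : #|f2 @: A2| = #|A2|.
  apply: card_in_imset => -[a b] [c d] /A2x[/= _ xa _] /A2x[/= _ xc _] [-> ac].
  by rewrite -(setD1K xa) ac setD1K.
have cA : #|A| <= #|A0| + #|A1| + #|A2|.
  apply: leq_trans (leq_add (leq_card_setU A0 A1) (leqnn _)).
  apply: leq_trans (leq_card_setU _ _); apply/subset_leq_card/subsetP => p Ap.
  by rewrite !inE Ap /= -negb_or; case: (x \in p.1); case: (x \in p.2).
have f12 : [disjoint f1 @: A1 & f2 @: A2].
  apply/pred0Pn => -[_ /andP[/imsetP[[a b] pA1 ->] /imsetP[[c d] qA2]]].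
  case: (A1x _ pA1) (A2x _ qA2) => /= Ap xa xb [/= Aq xd xc] [ac bd].
  have /eqP[] := Ane1 _ _ Ap Aq; rewrite -(cards1 x) /=; apply: eq_card => y.
  rewrite !inE; have [-> |yx] := eqVneq y x; first by rewrite xa xd.
  apply/negP => /andP[ya yd]; have := Adisj _ Ap => /= /disjoint_setI0 /setP /(_ y).
  by rewrite bd !inE yx ya yd.
have bound1 : #|A0 :|: f1 @: A1| <= 2 ^ n.
  (* Each member comes from a pair of [A] whose second set avoids [x], so deleting [x] from first
     sets changes no intersection. *)
  have lift p : p \in A0 :|: f1 @: A1 ->
      exists2 q, q \in A & [/\ x \notin q.2, p.1 = q.1 :\ x & p.2 = q.2].
    rewrite inE => /orP[|/imsetP[q /A1x[Aq _ xq] ->]]; last by exists q.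
    rewrite inE => /and3P[Ap xp xp']; exists p => //; split=> //.
    by apply/setP => y; rewrite !inE; case: eqVneq => // ->; apply/negbTE.
  apply: (IHn (D :\ x) Dn').
  - move=> p /lift[q Aq [xq -> ->]]; have /andP[q1 q2] := AD _ Aq.
    by rewrite setSD // subsetD1 q2.
  - move=> p /lift[q Aq [xq -> ->]].
    exact: disjointWl (subsetDl _ _) (Adisj _ Aq).
  - move=> p q /lift[p' Ap [xp -> _]] /lift[q' Aq [xq _ ->]].
    rewrite setIDAC (_ : _ :\ x = p'.1 :&: q'.2) ?Ane1 //.
    by apply/setDidPl; rewrite disjoint_sym disjoints1 inE (negPf xq) andbF.
have bound2 : #|A0 :|: f2 @: A2| <= 2 ^ n.
  have lift p : p \in A0 :|: f2 @: A2 ->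
      exists2 q, q \in A & [/\ x \notin q.1, p.1 = q.1 & p.2 = q.2 :\ x].
    rewrite inE => /orP[|/imsetP[q /A2x[Aq _ xq] ->]]; last by exists q.
    rewrite inE => /and3P[Ap xp xp']; exists p => //; split=> //.
    by apply/setP => y; rewrite !inE; case: eqVneq => // ->; apply/negbTE.
  apply: (IHn (D :\ x) Dn').
  - move=> p /lift[q Aq [xq -> ->]]; have /andP[q1 q2] := AD _ Aq.
    by rewrite setSD // subsetD1 q1 xq.
  - move=> p /lift[q Aq [xq -> ->]].
    exact: disjointWr (subsetDl _ _) (Adisj _ Aq).
  - move=> p q /lift[p' Ap [xp -> _]] /lift[q' Aq [xq _ ->]].
    rewrite setIDA (_ : _ :\ x = p'.1 :&: q'.2) ?Ane1 //.
    by apply/setDidPl; rewrite disjoint_sym disjoints1 inE (negPf xp).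
have := cardsUI A0 (f1 @: A1); have := cardsUI A0 (f2 @: A2).
(* The two intersections are disjoint parts of [A0]; by inclusion-exclusion the two unions together
   have at least [#|A0| + #|A1| + #|A2|] members. *)
have : #|A0 :&: f1 @: A1| + #|A0 :&: f2 @: A2| <= #|A0|.
  rewrite -cardsUI setIACA setIid (disjoint_setI0 f12) setI0 cards0 addn0.
  by apply: subset_leq_card; rewrite -setIUr subsetIl.
by rewrite expnS cA1 cA2 => h1 h2 h3; lia.
Qed.

Lemma udisj_cover_bound (n k : nat) (rows cols : 'I_k -> pred {set 'I_n}) :
  (forall a b : {set 'I_n}, [disjoint a & b] -> exists j, rows j a && cols j b) ->
  (forall j a b, rows j a -> cols j b -> #|a :&: b| != 1) ->
  3 ^ n <= k * 2 ^ n.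
Proof.
move=> cover valid.
pose A j := [set p : {set 'I_n} * {set 'I_n} |
  [&& [disjoint p.1 & p.2], rows j p.1 & cols j p.2]].
(* The values 0, 1 and 2 put an index in the first set, in the second, or in neither: hence [3 ^ n]
   disjoint pairs. *)
pose g (f : {ffun 'I_n -> 'I_3}) := ([set i | f i == inord 0], [set i | f i == inord 1]).
have g_inj : injective g.
  move=> f h [/setP f0 /setP f1]; apply/ffunP => i.
  move: (f0 i) (f1 i); rewrite !inE -!val_eqE /= !inordK //= => h0 h1.
  by apply/val_inj => /=; move: (ltn_ord (f i)) (ltn_ord (h i)) h0 h1; lia.
rewrite -[X in 3 ^ X](card_ord n) -{1}(card_ord 3) -card_ffun -(card_imset _ g_inj).
apply: (@leq_trans #|\bigcup_j A j|).
  apply/subset_leq_card/subsetP => _ /imsetP[f _ ->].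
  have dis : [disjoint (g f).1 & (g f).2].
    rewrite -setI_eq0; apply/eqP/setP => i; rewrite !inE.
    by apply/negP => /andP[/eqP -> ]; rewrite -val_eqE /= !inordK.
  by have [j rc] := cover _ _ dis; apply/bigcupP; exists j; rewrite // inE dis.
rewrite -[k in _ <= k * _]card_ord -sum_nat_const.
apply: (@leq_trans (\sum_(j < k) #|A j|)).
  elim/big_ind2: _ => [|S1 c1 S2 c2 h1 h2|//]; first by rewrite cards0.
  exact: leq_trans (leq_card_setU _ _) (leq_add h1 h2).
apply: leq_sum => j _; rewrite -[n in _ <= 2 ^ n]card_ord -cardsT.
apply: card_udisj_rect => [p|p|p q]; rewrite ?inE ?subsetT //; first by case/andP.
by move=> /and3P[_ r1 _] /and3P[_ _ c2]; apply: valid r1 c2.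
Qed.

(** * The formula and the occurrences of its literals *)

Lemma sumn_map_le1 (T : eqType) (s : seq T) (f : T -> nat) :
  uniq s -> {in s, forall p, f p <= 1} ->
  {in s &, forall p q, 0 < f p -> 0 < f q -> p = q} -> sumn (map f s) <= 1.
Proof.
elim: s => //= p s IHs /andP[ps us] f1 finj.
have {}IHs : sumn (map f s) <= 1.
  by apply: IHs => // [q qs|q r qs rs]; [apply: f1 | apply: finj]; rewrite inE ?qs ?rs orbT.
have [fp0|fp] := posnP (f p); first by rewrite fp0.
rewrite (_ : sumn (map f s) = 0); first by rewrite addn0 f1 ?mem_head.
apply/eqP; rewrite -[_ == 0]negbK -lt0n; apply/negP; rewrite sumnE big_map lt0n sum_nat_seq_neq0.
move=> /hasP[q qs]; rewrite -lt0n => fq; move: ps.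
by rewrite (finj p q) ?qs ?mem_head // inE qs orbT.
Qed.

Lemma occ_le1 (I : eqType) N (s : seq I) (cl : I -> clause N) (l : lit N) :
  uniq s -> (forall p, p \in s -> uniq (map fst (cl p))) ->
  {in s &, forall p q, l \in tval (cl p) -> l \in tval (cl q) -> p = q} ->
  sumn [seq count (fun l' => l' == l) (tval c) | c <- map cl s] <= 1.
Proof.
move=> us ucl inj; rewrite -map_comp; apply: sumn_map_le1 => //= [p ps|p q ps qs].
  by rewrite (count_uniq_mem _ (map_uniq (ucl p ps))) leq_b1.
by rewrite -!has_count !has_pred1; apply: inj.
Qed.

Lemma all_map_enum (I : finType) T (f : I -> T) (C : pred I) (Q : pred T) :
  all Q [seq f p | p <- enum I & C p] = [forall p, C p ==> Q (f p)].
Proof.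
rewrite all_map; apply/allP/forallP => [h p|h p].
  by apply/implyP => Cp; apply: h; rewrite mem_filter Cp mem_enum.
by rewrite mem_filter => /andP[Cp _]; apply: (implyP (h p)).
Qed.

(* [Cvar (i, t)] is the [t]-th copy of the negation of a bit [b_i], and
   [Xvar (i, j)] stands for an upper bound on [b_i && b_j]. *)
Definition var (n : nat) : finType :=
  ('I_n.+1 * 'I_n.+1 + 'I_n.+1 * 'I_n.+1 + 'I_n.+1 * 'I_n.+1)%type.
Definition Cvar n (p : 'I_n.+1 * 'I_n.+1) : var n := inl (inl p).
Definition Pad n (p : 'I_n.+1 * 'I_n.+1) : var n := inl (inr p).
Definition Xvar n (p : 'I_n.+1 * 'I_n.+1) : var n := inr p.

Lemma Cvar_inj n : injective (@Cvar n).
Proof. by move=> p q []. Qed.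

Definition vlit n (v : var n) (b : bool) : lit #|var n| := (enum_rank v, b).

(** The implications lead down to copy 0, the only copy that [cost] charges. *)
Definition chain_clause n (p : 'I_n.+1 * 'I_n.+1) : clause #|var n| :=
  [tuple vlit (Cvar p) false; vlit (Cvar (p.1, ord_pred p.2)) true; vlit (Pad p) true].
(** The copy indexed by the partner is used, so that no copy occurs in two of these clauses. *)
Definition prod_clause n (p : 'I_n.+1 * 'I_n.+1) : clause #|var n| :=
  [tuple vlit (Xvar p) true; vlit (Cvar p) true; vlit (Cvar (p.2, p.1)) true].

Definition udisj_cnf n : cnf #|var n| :=
  [seq chain_clause p | p : 'I_n.+1 * 'I_n.+1 <- enum {: 'I_n.+1 * 'I_n.+1} & p.2 != ord0] ++
  [seq prod_clause p | p : 'I_n.+1 * 'I_n.+1 <- enum {: 'I_n.+1 * 'I_n.+1} & p.1 < p.2].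

Lemma val_ord_pred n (t : 'I_n.+1) : t != ord0 -> ord_pred t = t.-1 :> nat.
Proof.
rewrite -val_eqE -lt0n /= => t0; rewrite -[t : nat]prednK // addSn /= modnDr.
by rewrite modn_small //; have := ltn_ord t; lia.
Qed.

Lemma chain_clause_uniq n (p : 'I_n.+1 * 'I_n.+1) :
  p.2 != ord0 -> uniq (map fst (chain_clause p)).
Proof.
case: p => i t /= t0; rewrite !inE !(inj_eq enum_rank_inj) /= !andbT orbF.
apply/eqP => -[] /(congr1 (@nat_of_ord _)); rewrite val_ord_pred //.
by move: t0; rewrite -val_eqE /=; lia.
Qed.

Lemma prod_clause_uniq n (p : 'I_n.+1 * 'I_n.+1) :
  p.1 < p.2 -> uniq (map fst (prod_clause p)).
Proof.
case: p => i j /= ij; rewrite !inE !(inj_eq enum_rank_inj) /= !andbT.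
by apply/eqP => -[] ij'; rewrite ij' ltnn in ij.
Qed.

Lemma udisj_cnf_proper n : proper_3cnf (udisj_cnf n).
Proof.
rewrite /proper_3cnf all_cat !all_map_enum.
by apply/andP; split; apply/forallP => p; apply/implyP;
  [exact: chain_clause_uniq | exact: prod_clause_uniq].
Qed.

Lemma vlit_inj n (u v : var n) b c : vlit u b = vlit v c -> u = v /\ b = c.
Proof. by case=> /enum_rank_inj -> ->. Qed.

(** A literal lies in at most one chain clause and at most one product clause, and product clauses
    contain no negated literal. *)
Lemma udisj_cnf_occ n (v : 'I_#|var n|) :
  pos_occ (udisj_cnf n) v <= 2 /\ neg_occ (udisj_cnf n) v <= 1.
Proof.
rewrite -(enum_valK v) /pos_occ /neg_occ !map_cat !sumn_cat.
move: (enum_val v) => {}v; rewrite -![(enum_rank v, _)]/(vlit v _).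
have chain_occ b : sumn [seq count (fun l => l == vlit v b) (tval c) |
    c <- [seq chain_clause p | p : 'I_n.+1 * 'I_n.+1 <- enum {: 'I_n.+1 * 'I_n.+1} & p.2 != ord0]] <= 1.
  apply: occ_le1 => [|p|p q]; first exact: filter_uniq (enum_uniq _).
     by rewrite mem_filter => /andP[/chain_clause_uniq].
  move=> _ _; rewrite !inE => /or3P[] /eqP/vlit_inj[-> ->] /or3P[] /eqP/vlit_inj[] //.
  - by case=> <-.
  - case: p q => [i s] [j t] /Cvar_inj/eqP; rewrite xpair_eqE /=.
    by move=> /andP[/eqP -> /eqP/ord_pred_inj ->].
  - by case=> <-.
have prod_occ b : sumn [seq count (fun l => l == vlit v b) (tval c) |
    c <- [seq prod_clause p | p : 'I_n.+1 * 'I_n.+1 <- enum {: 'I_n.+1 * 'I_n.+1} & p.1 < p.2]] <= b.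
  case: b; last first.
    rewrite leqn0 -map_comp sumnE big_map big1_seq // => p _ /=.
    by rewrite !xpair_eqE !andbF.
  apply: occ_le1 => [|p|[i j] [k l]]; first exact: filter_uniq (enum_uniq _).
    by rewrite mem_filter => /andP[/prod_clause_uniq].
  rewrite !mem_filter /= => /andP[ij _] /andP[kl _].
  rewrite !inE => /or3P[] /eqP/vlit_inj[-> _] /or3P[] /eqP/vlit_inj[] // [] E1 E2 _.
  - by rewrite E1 E2.
  - by rewrite E1 E2.
  - by move: ij kl; rewrite E1 E2; lia.
  - by move: ij kl; rewrite E1 E2; lia.
  - by rewrite E1 E2.
split; first exact: leq_add (chain_occ true) (prod_occ true).
exact: leq_add (chain_occ false) (prod_occ false).
Qed.

(** * Validity and tightness of the inequalities *)

(** Right-hand side coefficients without the constant 1. A pad weighs at least [#|a|], so a single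
    true pad suffices. *)
Definition cost n (a : {set 'I_n.+1}) (v : var n) : nat :=
  match v with
  | inl (inl p) => (p.1 \in a) && (p.2 == ord0)
  | inl (inr _) => n.+1
  | inr p => [&& p.1 \in a, p.2 \in a & p.1 < p.2]
  end.
Definition total_cost n (a : {set 'I_n.+1}) (x : 'I_#|var n| -> bool) : nat :=
  \sum_v cost a v * x (enum_rank v).

Lemma total_cost_ge n (a : {set 'I_n.+1}) (x : 'I_#|var n| -> bool) (S : {set var n}) :
  (forall v, v \in S -> 0 < cost a v /\ x (enum_rank v)) -> #|S| <= total_cost a x.
Proof.
move=> SP; rewrite -sum1_card big_mkcond /=; apply: leq_sum => v _.
by case: ifP => // /SP[c0 ->]; rewrite muln1.
Qed.

Lemma udisj_cnf_satP n (x : 'I_#|var n| -> bool) :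
  reflect
    ((forall i t, t != ord0 -> x (enum_rank (Cvar (i, t))) ->
        x (enum_rank (Cvar (i, ord_pred t))) || x (enum_rank (Pad (i, t)))) /\
     (forall i j : 'I_n.+1, i < j -> [|| x (enum_rank (Xvar (i, j))),
        x (enum_rank (Cvar (i, j))) | x (enum_rank (Cvar (j, i)))]))
    (cnf_sat (udisj_cnf n) x).
Proof.
rewrite /cnf_sat all_cat !all_map_enum; apply: (iffP andP).
  move=> [/forallP h1 /forallP h2]; split=> [i t t0 xc|i j ij].
    by have := h1 (i, t); rewrite t0 /= /lit_sat /= xc /= orbF !eqb_id.
  by have := h2 (i, j); rewrite /= ij /= /lit_sat /= orbF !eqb_id.
move=> [h1 h2]; split; apply/forallP => -[i j]; apply/implyP => ij.
  rewrite /= /lit_sat /= orbF !eqb_id.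
  by case xc: (x _) => //=; apply: h1.
by rewrite /= /lit_sat /= orbF !eqb_id; apply: h2.
Qed.

(** When all pads vanish, let [i0] be the least index of [a] whose copy 0 is false. Every other [i]
    in [a] is charged to a true variable of its own: its copy 0, or else [Xvar (i0, i)], which the
    product clause then forces. *)
Lemma card_le_total_cost n (a : {set 'I_n.+1}) (x : 'I_#|var n| -> bool) :
  cnf_sat (udisj_cnf n) x -> #|a| <= (total_cost a x).+1.
Proof.
move=> /udisj_cnf_satP[chain prod].
have [/existsP[p xp]|/existsPn nopad] := boolP [exists p, x (enum_rank (Pad p))].
  apply: leqW; rewrite /total_cost (bigD1 (Pad p)) //= xp muln1.
  by apply: leq_trans (leq_addr _ _); rewrite -[X in _ <= X]card_ord max_card.
have down i t : x (enum_rank (Cvar (i, t))) -> x (enum_rank (Cvar (i, ord0))).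
  move tk: (t : nat) => k; elim: k => [|k IHk] in t tk *.
    by rewrite (_ : t = ord0) //; apply: val_inj.
  have t0 : t != ord0 by rewrite -val_eqE /= tk.
  move=> /(chain _ _ t0); rewrite (negPf (nopad _)) orbF; apply: IHk.
  by rewrite val_ord_pred // tk.
pose B := [set i in a | ~~ x (enum_rank (Cvar (i, ord0)))].
have [i0 i0P] : exists i0, forall i, i \in B -> i != i0 -> (i0 \in B) && (i0 < i).
  have [B0|[i1 Bi1]] := set_0Vmem B; first by exists ord0 => i; rewrite B0 inE.
  case: (arg_minnP (fun i : 'I_n.+1 => i : nat) Bi1) => i0 Bi0 min; exists i0 => i Bi ii0.
  rewrite (Bi0 : i0 \in B) ltn_neqAle (min _ Bi) andbT /=.
  by move: ii0; rewrite -val_eqE eq_sym.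
pose h i := if x (enum_rank (Cvar (i, ord0))) then Cvar (i, ord0) else Xvar (i0, i).
apply: (@leq_trans #|a :\ i0|.+1); first by rewrite (cardsD1 i0 a); case: (_ \in _).
rewrite ltnS -(@card_imset _ _ h); last first.
  by move=> i j; rewrite /h; case: ifP => _; case: ifP => _ // [].
apply: total_cost_ge => _ /imsetP[i /setD1P[ii0 ai] ->]; rewrite /h.
case: ifPn => [xi|nxi]; first by rewrite /= ai.
have /i0P/(_ ii0) : i \in B by rewrite inE ai.
rewrite inE => /andP[/andP[ai0 nxi0] lt_i]; rewrite /= ai0 ai lt_i; split=> //.
have := prod _ _ lt_i; case/or3P=> // /down; first by rewrite (negPf nxi0).
by rewrite (negPf nxi).
Qed.

Definition bit_assignment n (b : {set 'I_n.+1}) (k : 'I_#|var n|) : bool :=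
  match enum_val k with
  | inl (inl p) => p.1 \notin b
  | inl (inr _) => false
  | inr p => (p.1 \in b) && (p.2 \in b)
  end.

Lemma bit_assignment_sat n (b : {set 'I_n.+1}) :
  cnf_sat (udisj_cnf n) (bit_assignment b).
Proof.
apply/udisj_cnf_satP; rewrite /bit_assignment; split=> [i t|i j];
  rewrite !enum_rankK /=; first by move=> _ ->.
by case: (i \in b); case: (j \in b).
Qed.

Lemma total_cost_disjoint n (a b : {set 'I_n.+1}) :
  [disjoint a & b] -> #|a| <= total_cost a (bit_assignment b).
Proof.
move=> dab; rewrite -(@card_imset _ _ (fun i => Cvar (i, ord0))); last by move=> i j [].
apply: total_cost_ge => _ /imsetP[i ai ->].
by rewrite /bit_assignment enum_rankK /= ai (disjointFr dab).
Qed.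

(** One inequality is validity. For the other, [a] and [b] share no two indices, so the only true
    variables with a cost are the copies 0 of indices in [a] outside [b]. *)
Lemma total_cost_meet1 n (a b : {set 'I_n.+1}) :
  #|a :&: b| = 1 -> (total_cost a (bit_assignment b)).+1 = #|a|.
Proof.
move=> ab1; apply/eqP; rewrite eqn_leq card_le_total_cost ?bit_assignment_sat // andbT.
rewrite -(cardsID b a) ab1 add1n ltnS.
rewrite -(@card_imset _ _ (fun i => Cvar (i, ord0))); last by move=> i j [].
rewrite -sum1_card big_mkcond; apply: leq_sum => v _ /=.
rewrite /bit_assignment enum_rankK; case: v => [[[i t]|p]|[i j]] /=.
- case: andP => [[ai /eqP->]|//]; case nbi: (i \notin b); rewrite ?muln0 //.
  by rewrite imset_f // inE ai nbi.
- by rewrite muln0.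
- case: and3P => [[ai aj ij]|//]; case: andP => [[bi bj]|]; rewrite ?muln0 //.
  have /eqP/cards1P[k /setP abk] := ab1.
  have := abk i; have := abk j; rewrite !inE ai aj bi bj.
  by move=> /esym/eqP jk /esym/eqP ik; rewrite jk ik ltnn in ij.
Qed.

(** * The lower bound on extension complexity *)

Section ExtensionComplexity.
Local Open Scope ring_scope.

(** Negated because [rectangle_cover] expects upper bounds. *)
Definition cost_functional n (a : {set 'I_n.+1}) : vec #|var n| :=
  fun k => - (cost a (enum_val k))%:R.

Lemma dot_cost_functional n (a : {set 'I_n.+1}) (x : 'I_#|var n| -> bool) z :
  (forall i, z i = if x i then R1 else R0) ->
  dot (cost_functional a) z = - (total_cost a x)%:R.
Proof.
move=> zE; rewrite dotE (reindex_onto enum_rank enum_val) /=; last first.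
  by move=> k _; rewrite enum_valK.
rewrite natr_sum -sumrN; apply: eq_big => [v|v _]; first by rewrite enum_rankK eqxx.
rewrite /cost_functional enum_rankK zE mulNr; congr (- _).
by case: (x _); rewrite ?muln1 ?muln0; [exact: mulr1 | exact: mulr0].
Qed.

Lemma xc_udisj_cnf n k :
  xc_le (sat_polytope (udisj_cnf n)) k -> (3 ^ n.+1 <= k.+1 * 2 ^ n.+1)%N.
Proof.
move=> xck; pose z (b : {set 'I_n.+1}) : vec #|var n| :=
  fun i => if bit_assignment b i then R1 else R0.
have Pz b : sat_polytope (udisj_cnf n) (z b).
  by apply: hull_base; exists (bit_assignment b); split=> //; apply: bit_assignment_sat.
have zE a b : dot (cost_functional a) (z b) = - (total_cost a (bit_assignment b))%:R.
  exact: dot_cost_functional.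
pose delta (a : {set 'I_n.+1}) : R := 1 - #|a|%:R.
have deltaE a b : dot (cost_functional a) (z b) = delta a <->
    (total_cost a (bit_assignment b)).+1 = #|a|.
  rewrite zE /delta; split=> [h|<-]; last by rewrite -natr1; lra.
  by apply/eqP; rewrite -(eqr_nat R) -natr1; apply/eqP; lra.
have [a y Py|rows [cols [sound complete]]] :=
    rectangle_cover (w := @cost_functional n) (delta := delta) xck _ Pz.
  have [T [_ _ /(_ (cost_functional a) (delta a))[]//]] := hull_carrier Py.
  move=> v [x [sat_x vE]]; rewrite (dot_cost_functional _ vE) /delta.
  have := card_le_total_cost a sat_x; rewrite -(ler_nat R) -natr1; lra.
(* The inequality of [a = set0] defines an empty face, so it gets a rectangle of its own. *)
pose rows' (j : 'I_k.+1) := if unlift ord0 j is Some i then rows i else pred1 set0.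
pose cols' (j : 'I_k.+1) := if unlift ord0 j is Some i then cols i else xpredT.
apply: (@udisj_cover_bound _ _ rows' cols') => [a b dab|j a b].
  have [->|/set0Pn[i ai]] := eqVneq a set0.
    by exists ord0; rewrite /rows' /cols' unlift_none /= eqxx.
  have [||j rcj] := complete a b.
  (* The point of a singleton inside [a] is tight, so the face of [a] is nonempty. *)
  - exists (z [set i]) => //; apply/deltaE/total_cost_meet1.
    by rewrite (setIidPr _) ?cards1 // sub1set.
  - by move/deltaE => E; have := total_cost_disjoint dab; rewrite -E ltnn.
  by exists (lift ord0 j); rewrite /rows' /cols' liftK.
rewrite /rows' /cols'; case: unliftP => [i _|_ /= /eqP -> _]; last by rewrite set0I cards0.
move=> ra cb; apply/eqP => ab1; apply: (sound i a b ra cb).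
exact/deltaE/total_cost_meet1.
Qed.

End ExtensionComplexity.

(** * Growth rates and the family of formulas *)

Lemma exp_dominates_poly c : exists k, 1 <= k /\ (c * (k * k) ^ c).+1 * 2 ^ k < 3 ^ k.
Proof.
(* With [k = 2 * q], the factor need only be at most [2 ^ q], as 2 * 4 < 9. Taking [q] a power of 2
   makes [(k * k) ^ c] the power of 2 with exponent [2 * r.+1 * c], and [q = 8 * 4 ^ c] outgrows
   this exponent. *)
pose r := 2 * c + 3; pose q := 2 ^ r; exists (2 * q).
have q_gt0 : 0 < q by rewrite expn_gt0.
split; first by lia.
have hr : c * (2 * r.+1) + c < q.
  have c2 : c.+1 <= 2 ^ c by apply: ltn_expl.
  have -> : q = 8 * (2 ^ c * 2 ^ c) by rewrite /q /r expnD mulnC mul2n -addnn expnD.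
  by rewrite /r; nia.
have h : (c * (2 * q * (2 * q)) ^ c).+1 <= 2 ^ q.
  rewrite -expnS -expnD -expnM.
  apply: (@leq_trans (2 ^ (c * (2 * r.+1) + c))); last by rewrite leq_exp2l // ltnW.
  rewrite expnD [X in _ < X]mulnC (_ : (r.+1 + r.+1) * c = c * (2 * r.+1)); last by lia.
  by rewrite ltn_mul2r expn_gt0 ltn_expl.
apply: (@leq_ltn_trans (2 ^ q * 2 ^ (2 * q))); first by rewrite leq_mul2r h orbT.
rewrite !expnM -expnMn ltn_exp2r //.
Qed.

Theorem theorem4 :
  exists (Nv : nat -> nat) (phi : forall n : nat, cnf (Nv n)),
    (* O(n) variables *)
    (exists C : nat, forall n : nat, (1 <= n)%N -> (Nv n <= C * n)%N) /\
    (* size (number of clauses) polynomial in n *)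
    (exists C : nat, forall n : nat, (1 <= n)%N -> (size (phi n) <= C * n ^ C)%N) /\
    (* each clause has three literals on distinct variables *)
    (forall n : nat, (1 <= n)%N -> proper_3cnf (phi n)) /\
    (* each variable occurs at most twice non-negated, at most once negated *)
    (forall n : nat, (1 <= n)%N -> forall v : 'I_(Nv n),
        (pos_occ (phi n) v <= 2)%N /\ (neg_occ (phi n) v <= 1)%N) /\
    (* xc(sat polytope of phi_n) is not bounded by any polynomial in n *)
    (forall c : nat, exists n : nat,
        (1 <= n)%N /\ ~ xc_le (sat_polytope (phi n)) (c * n ^ c)).
Proof.
(* There are three variables per pair of indices, so the number of bits must be of order the square
   root of [n]. The constants 12 and 8 below are 3 * 4 and 2 * 4. *)
pose m := Nat.sqrt; exists (fun n => #|var (m n)|), (fun n => udisj_cnf (m n)).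
have pairs_le n : 1 <= n -> (m n).+1 * (m n).+1 <= 4 * n.
  move=> n1; have := Nat.sqrt_spec' n; have := Nat.sqrt_le_mono 1 n.
  by rewrite /m /=; nia.
split; [|split; [|split; [|split]]].
- exists 12 => n /pairs_le; rewrite !card_sum !card_prod !card_ord; lia.
- exists 8 => n n1; have n8 : n <= n ^ 8 by rewrite -[X in X <= _]expn1 leq_pexp2l.
  rewrite size_cat !size_map !size_filter.
  apply: (@leq_trans (2 * ((m n).+1 * (m n).+1))); last by have := pairs_le n n1; lia.
  rewrite mul2n -addnn; apply: leq_add; apply: leq_trans (count_size _ _) _;
    by rewrite -cardE card_prod !card_ord.
- by move=> n _; apply: udisj_cnf_proper.
- by move=> n _ v; apply: udisj_cnf_occ.
move=> c; have [k [k1 klt]] := exp_dominates_poly c; exists (k * k); split; first by lia.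
have -> : m (k * k) = k by apply: Nat.sqrt_square.
move=> /xc_udisj_cnf; rewrite leqNgt => /negP; apply.
rewrite 2!expnS mulnCA; move: klt; lia.
Qed.
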